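(* Consider the online knapsack problem with departures described in the context, and suppose Assumptions (A1)–(A3) hold. There exist parameters $\gamma_k = O(\ln(\alpha_k\theta_k))$, $k\in[K]$, such that the following holds: if the item sizes satisfy $\varepsilon_k \le C_k\ln 2/\gamma_k$ for all $k\in[K]$, and the algorithm $\mathrm{OA}(\phi)$ described in the context is run with the threshold functions $$\phi_k(z) = \exp\left(z\gamma_k/C_k\right) - 1,\qquad z\in[0,C_k],\ k\in[K],$$ then the competitive ratio of this algorithm is $O(\ln(\alpha\theta))$, where $\theta=\max_{k\in[K]}\theta_k$ and $\alpha=\max_{k\in[K]}\alpha_k$.
   Context: Online knapsack with departures: there are $K$ knapsacks and a slotted time horizon $[T]=\{1,\dots,T\}$; knapsack $k\in[K]$ has capacity $C_k>0$. Items $n=1,\dots,N$ arrive one by one; item $n$ is described by $\mathcal{I}_n=\{a_n,\{w_{nk},v_{nk},\mathcal{T}_{nk}\}_{k\in[K]}\}$, where $a_n$ is its arrival time and, for knapsack $k$, $w_{nk}>0$ is its size, $v_{nk}>0$ its value, and $\mathcal{T}_{nk}=\{s_{nk},\dots,s_{nk}+d_{nk}-1\}$ the set of $d_{nk}$ consecutive time slots it would occupy in knapsack $k$ ($d_{nk}$ is its duration). Upon arrival of item $n$, an online algorithm must irrevocably choose $x_{nk}\in\{0,1\}$, $k\in[K]$, with $\sum_k x_{nk}\le 1$ (all zero means rejection), using only $\mathcal{I}_1,\dots,\mathcal{I}_n$, subject to the capacity constraints $\sum_{n: t\in\mathcal{T}_{nk}} w_{nk}x_{nk}\le C_k$ for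 all $k\in[K]$, $t\in[T]$. Its value on instance $\mathcal{I}=\{\mathcal{I}_n\}_{n\in[N]}$ is $\mathrm{ALG}(\mathcal{I})=\sum_{n,k} v_{nk}x_{nk}$. $\mathrm{OPT}(\mathcal{I})$ is the optimal value of the same integer program solved offline with full knowledge of $\mathcal{I}$. The competitive ratio is $\max_{\mathcal{I}}\mathrm{OPT}(\mathcal{I})/\mathrm{ALG}(\mathcal{I})$ over all instances satisfying the assumptions. Assumptions: (A1) $v_{nk}/(w_{nk}d_{nk})\in[1,\theta_k]$ for all $n,k$; (A2) $d_{nk}\in[\underline{D}_k,\overline{D}_k]$ for all $n,k$, and $\alpha_k=\overline{D}_k/\underline{D}_k$; (A3) $w_{nk}\le\varepsilon_k\le C_k$ for all $n,k$. Algorithm $\mathrm{OA}(\phi)$ with threshold functions $\phi=\{\phi_k\}_{k\in[K]}$: maintain utilizations $z_{kt}$, initially $0$ for all $k,t$. When item $n$ arrives, for each knapsack $k$ compute $\Phi_{nk}=\sum_{t\in\mathcal{T}_{nk}} w_{nk}\phi_k(z_{kt})$ and set $\hat{x}_{nk}=1$ if $v_{nk}\ge\Phi_{nk}$ and $z_{kt}+w_{nk}\le C_k$ for all $t\in\mathcal{T}_{nk}$, else $\hat{x}_{nk}=0$. If some $\hat{x}_{nk}=1$, admit item $n$ to $k'=\arg\max_{k:\hat{x}_{nk}=1} v_{nk}$ (set $x_{nk'}=1$, others $0$); otherwise reject it. Then update $z_{kt}\leftarrow z_{kt}+w_{nk}x_{nk}$ for all $k$ and $t\in\mathcal{T}_{nk}$.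 *)

(* Defs.v *)
From mathcomp Require Import all_boot all_order all_algebra.
From mathcomp Require Import all_classical all_reals all_analysis.

Set Implicit Arguments.
Unset Strict Implicit.
Unset Printing Implicit Defensive.

Import Order.TTheory GRing.Theory Num.Theory.
Local Open Scope ring_scope.

(* The data known in advance. The duration bounds are real numbers, so that
   they need not be attained by integer durations. *)
Record setting (R : realType) (K : nat) := Setting {
  horizon : nat;
  cap : 'I_K -> R;
  theta : 'I_K -> R;
  dur_lo : 'I_K -> R;
  dur_hi : 'I_K -> R;
  eps : 'I_K -> R }.

Definition alpha (R : realType) (K : nat) (S : setting R K) (k : 'I_K) : R :=
  dur_hi S k / dur_lo S k.

(* For K > 0 and positive families, the default 0 plays no role. *)
Definition theta_max (R : realType) (K : nat) (S : setting R K) : R :=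
  \big[Num.max/0]_(k < K) theta S k.

Definition alpha_max (R : realType) (K : nat) (S : setting R K) : R :=
  \big[Num.max/0]_(k < K) alpha S k.

(* Besides the positivity of the capacities and eps_k <= C_k, this says that
   the intervals [1, theta_k] and [dur_lo_k, dur_hi_k] are nonempty, the latter
   with a positive lower end. *)
Definition valid_setting (R : realType) (K : nat) (S : setting R K) : Prop :=
  (0 < K)%N /\
  forall k, [/\ 0 < cap S k, eps S k <= cap S k, 1 <= theta S k,
                0 < dur_lo S k & dur_lo S k <= dur_hi S k].

Record item (R : realType) (K : nat) := Item {
  arrival : nat;
  weight : 'I_K -> R;
  value : 'I_K -> R;
  start : 'I_K -> nat;
  dur : 'I_K -> nat }.

Definition slots (R : realType) (K : nat) (it : item R K) (k : 'I_K) : seq nat :=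
  iota (start it k) (dur it k).

(* Items are numbered from 0; only items_of 0, ..., items_of (nb_items - 1)
   belong to the instance. *)
Record instance (R : realType) (K : nat) := Instance {
  nb_items : nat;
  items_of : nat -> item R K }.

(* The time slots of the horizon are 1, ..., horizon. Arrival times are left
   unconstrained: they enter neither OPT nor the admission rule. *)
Definition valid_item (R : realType) (K : nat) (S : setting R K)
    (it : item R K) : Prop :=
  forall k,
    [/\ 0 < weight it k, 0 < value it k &
        {subset slots it k <= iota 1 (horizon S)}] /\
    [/\ 1 <= value it k / (weight it k * (dur it k)%:R) <= theta S k,
        dur_lo S k <= (dur it k)%:R <= dur_hi S k &
        weight it k <= eps S k].

Definition valid_instance (R : realType) (K : nat) (S : setting R K)
    (I : instance R K) : Prop :=
  forall n, (n < nb_items I)%N -> valid_item S (items_of I n).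

Definition total_value (R : realType) (K : nat) (I : instance R K)
    (x : 'I_(nb_items I) -> 'I_K -> bool) : R :=
  \sum_(n < nb_items I) \sum_(k < K) value (items_of I n) k * (x n k)%:R.

Definition feasible (R : realType) (K : nat) (S : setting R K)
    (I : instance R K) (x : 'I_(nb_items I) -> 'I_K -> bool) : bool :=
  [forall n, (\sum_(k < K) x n k <= 1)%N] &&
  [forall k, all (fun t =>
     \sum_(n < nb_items I | t \in slots (items_of I n) k)
        weight (items_of I n) k * (x n k)%:R <= cap S k)
   (iota 1 (horizon S))].

(* The zero allocation is feasible with value 0, so the default 0 is harmless. *)
Definition OPT (R : realType) (K : nat) (S : setting R K)
    (I : instance R K) : R :=
  \big[Num.max/0]_(x : {ffun 'I_(nb_items I) -> {ffun 'I_K -> bool}} |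
      feasible S (fun n k => x n k))
    total_value (fun n k => x n k).

(* Ties in the argmax are broken by an arbitrary rule, which may depend on all
   the items seen so far (the current one included). *)
Definition tie_rule (R : realType) (K : nat) : Type :=
  seq (item R K) -> {set 'I_K} -> 'I_K.

Definition valid_tie_rule (R : realType) (K : nat) (tie : tie_rule R K) : Prop :=
  forall h A, A != finset.set0 -> tie h A \in A.

Definition OA_price (R : realType) (K : nat) (phi : 'I_K -> R -> R)
    (z : 'I_K -> nat -> R) (it : item R K) (k : 'I_K) : R :=
  \sum_(t <- slots it k) weight it k * phi k (z k t).

Definition OA_candidates (R : realType) (K : nat) (S : setting R K)
    (phi : 'I_K -> R -> R) (z : 'I_K -> nat -> R) (it : item R K) : {set 'I_K} :=
  [set k | (OA_price phi z it k <= value it k) &&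
           all (fun t => z k t + weight it k <= cap S k) (slots it k)]%SET.

Definition OA_argmax (R : realType) (K : nat) (it : item R K)
    (A : {set 'I_K}) : {set 'I_K} :=
  [set k in A | [forall j in A, value it j <= value it k]]%SET.

Definition OA_decide (R : realType) (K : nat) (S : setting R K)
    (phi : 'I_K -> R -> R) (tie : tie_rule R K) (h : seq (item R K))
    (z : 'I_K -> nat -> R) (it : item R K) (k : 'I_K) : bool :=
  let A := OA_candidates S phi z it in
  (A != finset.set0) && (k == tie h (OA_argmax it A)).

(* OA_util n is the table of utilizations z_kt when item n arrives. *)
Fixpoint OA_util (R : realType) (K : nat) (S : setting R K)
    (phi : 'I_K -> R -> R) (tie : tie_rule R K) (I : instance R K)
    (n : nat) : 'I_K -> nat -> R :=
  if n is m.+1 then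
    let z := OA_util S phi tie I m in
    let it := items_of I m in
    let x := OA_decide S phi tie (mkseq (items_of I) m.+1) z it in
    fun k t => if t \in slots it k then z k t + weight it k * (x k)%:R
               else z k t
  else fun _ _ => 0.

Definition OA_alloc (R : realType) (K : nat) (S : setting R K)
    (phi : 'I_K -> R -> R) (tie : tie_rule R K) (I : instance R K)
    (n : nat) (k : 'I_K) : bool :=
  OA_decide S phi tie (mkseq (items_of I) n.+1)
    (OA_util S phi tie I n) (items_of I n) k.

Definition ALG (R : realType) (K : nat) (S : setting R K)
    (phi : 'I_K -> R -> R) (tie : tie_rule R K) (I : instance R K) : R :=
  total_value (fun n : 'I_(nb_items I) => OA_alloc S phi tie I n).

(* The quotient is taken in the extended reals, where y / 0 = +oo for y > 0 and
   0 / 0 = 0: an instance with ALG = 0 < OPT makes the ratio infinite. *)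
Definition competitive_ratio (R : realType) (K : nat) (S : setting R K)
    (phi : 'I_K -> R -> R) (tie : tie_rule R K) : \bar R :=
  ereal_sup [set ((OPT S I)%:E / (ALG S phi tie I)%:E)%E |
             I in [set I | valid_instance S I]]%classic.

Definition exp_threshold (R : realType) (K : nat) (S : setting R K)
    (gamma : R -> R -> R) (k : 'I_K) (z : R) : R :=
  expR (z * gamma (alpha S k) (theta S k) / cap S k) - 1.

(* Main.v *)
(* Take gamma_k = 2 ln (4 alpha_k theta_k) and argue by linear-programming
   duality. The potential sum_(k, t) C_k phi_k(z_kt) grows by at most
   4 gamma_k v_nk when item n is admitted to knapsack k, so it stays below
   4 max_k gamma_k ALG. An item of OPT is charged to the value ALG collects on
   it, to its price, or, if it was rejected because a slot tau was full, to a
   smoothed price. The items covering tau have length at least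
   L = ceil (dur_lo_k), so slots at distance L on both sides of tau carry, in
   pairs, the utilization of tau, and one slot of each pair is at least half
   full; the choice of gamma_k makes the average of phi_k(z_kt) over a window of
   width 4 dur_hi_k then exceed theta_k, while averaging multiplies the total
   price by at most 4. Weak duality gives
   OPT <= (1 + 20 max_k gamma_k) ALG. *)
Require Import Defs.
From mathcomp Require Import all_boot all_order all_algebra.
From mathcomp Require Import all_classical all_reals all_analysis.
From mathcomp Require Import zify ring lra.
Import Order.TTheory GRing.Theory Num.Theory.
Local Open Scope ring_scope.

Set Implicit Arguments.
Unset Strict Implicit.
Unset Printing Implicit Defensive.

(** * Sums over duplicate-free sequences *)

Lemma perm_filter_mem (T : eqType) (r1 r2 : seq T) :
  uniq r1 -> uniq r2 -> {subset r1 <= r2} -> perm_eq r1 [seq t <- r2 | t \in r1].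
Proof.
move=> u1 u2 sub12; apply: uniq_perm => //; first exact: filter_uniq.
by move=> t; rewrite mem_filter /=; case: (boolP (t \in r1)) => //= /sub12 ->.
Qed.

Lemma sum_mem_uniq {R : pzRingType} (T : eqType) (r1 r2 : seq T) (F : T -> R) :
  uniq r1 -> uniq r2 -> {subset r1 <= r2} ->
  \sum_(t <- r1) F t = \sum_(t <- r2) (t \in r1)%:R * F t.
Proof.
move=> u1 u2 sub12; rewrite (perm_big _ (perm_filter_mem u1 u2 sub12)) /=.
rewrite big_filter big_mkcond /=; apply: eq_bigr => t _.
by case: ifP => _; rewrite ?mul1r ?mul0r.
Qed.

Lemma ler_sum_uniq {R : numDomainType} (T : eqType) (r1 r2 : seq T)
    (F : T -> R) :
  (forall t, 0 <= F t) -> uniq r1 -> uniq r2 -> {subset r1 <= r2} ->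
  \sum_(t <- r1) F t <= \sum_(t <- r2) F t.
Proof.
move=> F0 u1 u2 sub12; rewrite (sum_mem_uniq F u1 u2 sub12).
by apply: ler_sum => t _; case: (t \in r1); rewrite ?mul1r ?mul0r.
Qed.

(** * Window averages *)

(* The subtraction is truncated: slots before time 0 are read as slot 0, where
   the functions of interest vanish. *)
Definition smooth {R : realType} (H : nat) (f : nat -> R) (s : nat) : R :=
  H%:R^-1 * \sum_(i <- iota 0 (4 * H)) f (s + i - 2 * H)%N.

Section Smoothing.
Context {R : realType}.
Variable f : nat -> R.
Hypothesis f_ge0 : forall t, 0 <= f t.

Lemma smooth_ge0 H s : 0 <= smooth H f s.
Proof. by rewrite mulr_ge0 ?invr_ge0 ?ler0n ?sumr_ge0. Qed.

(** The truncated shift is injective on the slots it sends into the horizon; on the others [f]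
    contributes 0. *)
Lemma sum_shift_le T i j : (forall t, t \notin iota 1 T -> f t = 0) ->
  \sum_(s <- iota 1 T) f (s + i - j)%N <= \sum_(t <- iota 1 T) f t.
Proof.
move=> f0.
pose h s := (s + i - j)%N.
have -> : \sum_(s <- iota 1 T) f (s + i - j)%N =
    \sum_(t <- map h [seq s <- iota 1 T | h s \in iota 1 T]) f t.
  rewrite big_map big_filter [RHS]big_mkcond /=; apply: eq_bigr => s _.
  by case: ifP => // /negbT /f0.
apply: ler_sum_uniq => //; first 1 last.
- exact: iota_uniq.
- by move=> t /mapP[s]; rewrite mem_filter => /andP[+ _] ->.
rewrite map_inj_in_uniq ?filter_uniq ?iota_uniq // => s t.
by rewrite !mem_filter !mem_iota /h => + + ; lia.
Qed.

(** Each of the [4 * H] shifts contributes at most the full sum, and dividing by [H] leaves 4. *)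
Lemma smooth_total H T : (forall t, t \notin iota 1 T -> f t = 0) ->
  \sum_(s <- iota 1 T) smooth H f s <= 4 * \sum_(t <- iota 1 T) f t.
Proof.
move=> f0; rewrite /smooth -mulr_sumr exchange_big /=.
have F0 : 0 <= \sum_(t <- iota 1 T) f t by exact: sumr_ge0.
have le1 : \sum_(i <- iota 0 (4 * H)) \sum_(s <- iota 1 T) f (s + i - 2 * H)%N
    <= (4 * H)%:R * \sum_(t <- iota 1 T) f t.
  apply: (@le_trans _ _ (\sum_(i <- iota 0 (4 * H)) \sum_(t <- iota 1 T) f t)).
    by apply: ler_sum => i _; exact: sum_shift_le.
  by rewrite big_const_seq count_predT size_iota iter_addr_0 mulr_natl.
(* For [H = 0] the inverse is 0 by convention, so the left side vanishes. *)
case: H le1 => [|H] le1; first by rewrite invr0 mul0r mulr_ge0.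
by rewrite ler_pdivrMl ?ltr0Sn // mulrCA mulrA -natrM.
Qed.

(** The pairs in the hypothesis run through the [2 * L] slots from [tau + 1 - L] to [tau + L], all
    inside the window of [s], and sum to at least [L * b]. *)
Lemma smooth_window (H L tau s : nat) (b : R) :
  (L <= H)%N -> (s < tau + H)%N -> (tau < s + H)%N ->
  (forall j, (j < L)%N -> b <= f (tau + j + 1 - L) + f (tau + j + 1)%N) ->
  L%:R / H%:R * b <= smooth H f s.
Proof.
move=> LH sH tauH bf; rewrite /smooth mulrAC mulrC.
apply: ler_wpM2l; first by rewrite invr_ge0 ler0n.
(* The index at which the window of [s] reaches [tau]. *)
pose i0 := (tau + 2 * H - s)%N.
pose F i := f (s + i - 2 * H)%N.
apply: (@le_trans _ _ (\sum_(i <- iota (i0 + 1 - L) (L + L)) F i)); last first.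
  apply: ler_sum_uniq; [by move=> i; exact: f_ge0|exact: iota_uniq..|].
  by move=> i; rewrite !mem_iota /i0; lia.
have shift a : iota a L = map (addn a) (iota 0 L) by rewrite -iotaDl addn0.
rewrite iotaD big_cat /= (shift (i0 + 1 - L)%N) (shift (i0 + 1 - L + L)%N).
rewrite !big_map -big_split /=.
apply: (@le_trans _ _ (\sum_(i <- iota 0 L) b)).
  by rewrite big_const_seq count_predT size_iota iter_addr_0 mulr_natl.
rewrite big_seq [leRHS]big_seq; apply: ler_sum => j; rewrite mem_iota => jL.
rewrite /F; have := bf j ltac:(lia).
congr (_ <= f _ + f _); rewrite /i0; lia.
Qed.

End Smoothing.

(** * The rate and exponential estimates *)

Definition oa_rate {R : realType} (a th : R) : R := 2 * ln (4 * (a * th)).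

Section Rate.
Context {R : realType}.
Implicit Types a th : R.

Lemma oa_rate_gt0 a th : 1 <= a -> 1 <= th -> 0 < oa_rate a th.
Proof. by move=> a1 th1; rewrite mulr_gt0 // ln_gt0 //; nra. Qed.

Lemma oa_rateE a th : 1 <= a -> 1 <= th ->
  oa_rate a th = 2 * ln 4 + 2 * ln (a * th).
Proof. by move=> a1 th1; rewrite /oa_rate lnM ?posrE ?mulrDr //; nra. Qed.

(** Half the utilization of a full slot gives at least this exponent. The factor 2 in [oa_rate]
    undoes the halving; the 4 absorbs [ln 2] and the added 1, as [2 * (a * th) >= a * th + 1]. *)
Lemma expR_oa_rate a th : 1 <= a -> 1 <= th ->
  expR ((oa_rate a th - ln 2) / 2) >= a * th + 1.
Proof.
move=> a1 th1.
have ath : 1 <= a * th by nra.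
have ln2 : 0 < ln (2 : R) by rewrite ln_gt0 // ltr1n.
apply: (@le_trans _ _ (expR (ln (4 * (a * th)) - ln 2))); last first.
  by rewrite ler_expR /oa_rate; lra.
by rewrite expRB !lnK ?posrE //; lra.
Qed.

(** From [expR (- x) >= 1 - x] follows [expR x - 1 <= x * expR x], and here [expR x <= 2]. *)
Lemma expR_sub1_le (x : R) : 0 <= x -> x <= ln 2 -> expR x - 1 <= 2 * x.
Proof.
move=> x0 x2.
have e2 : expR x <= 2 by rewrite -[leRHS]lnK ?posrE // ler_expR.
have := expR_ge1Dx (- x); rewrite expRN -(ler_pM2r (expR_gt0 x)).
rewrite mulVf ?gt_eqF ?expR_gt0 // => le1.
have := expR_ge1Dx x; nra.
Qed.

End Rate.

(** * Consequences of the assumptions *)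

Section Competitiveness.
Context {R : realType} {K : nat}.
Variables (S : setting R K) (tie : tie_rule R K) (I : instance R K).
Hypotheses (validS : valid_setting S) (validtie : valid_tie_rule tie).
Hypothesis (validI : valid_instance S I).

Local Notation g k := (oa_rate (alpha S k) (theta S k)).
Local Notation phi := (exp_threshold S oa_rate).
Local Notation N := (nb_items I).
Local Notation it n := (items_of I n).
Local Notation z := (OA_util S phi tie I).
Local Notation x := (OA_alloc S phi tie I).
Local Notation slotsT := (iota 1 (horizon S)).

Hypothesis eps_small : forall k, eps S k <= cap S k * ln 2 / g k.

Lemma cap_gt0 k : 0 < cap S k.
Proof. by case: validS => _ /(_ k)[]. Qed.

Lemma theta_ge1 k : 1 <= theta S k.
Proof. by case: validS => _ /(_ k)[]. Qed.

Lemma alpha_ge1 k : 1 <= alpha S k.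
Proof. by case: validS => _ /(_ k)[? ? ? lo0 lohi]; rewrite ler_pdivlMr ?mul1r. Qed.

Lemma rate_gt0 k : 0 < g k.
Proof. by apply: oa_rate_gt0; [exact: alpha_ge1|exact: theta_ge1]. Qed.

Lemma weight_gt0 n k : (n < N)%N -> 0 < weight (it n) k.
Proof. by move=> /validI/(_ k)[[]]. Qed.

Lemma value_gt0 n k : (n < N)%N -> 0 < value (it n) k.
Proof. by move=> /validI/(_ k)[[]]. Qed.

Lemma weight_le_eps n k : (n < N)%N -> weight (it n) k <= eps S k.
Proof. by move=> /validI/(_ k)[_ []]. Qed.

Lemma slots_sub n k : (n < N)%N -> {subset slots (it n) k <= slotsT}.
Proof. by move=> /validI/(_ k)[[]]. Qed.

Lemma dur_bounds n k : (n < N)%N ->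
  dur_lo S k <= (dur (it n) k)%:R <= dur_hi S k.
Proof. by move=> /validI/(_ k)[_ []]. Qed.

Lemma dur_gt0 n k : (n < N)%N -> 0 < (dur (it n) k)%:R :> R.
Proof.
move=> /(dur_bounds k)/andP[+ _]; apply: lt_le_trans.
by case: validS => _ /(_ k)[].
Qed.

Lemma value_ge n k : (n < N)%N ->
  weight (it n) k * (dur (it n) k)%:R <= value (it n) k.
Proof.
move=> nN; have [_ [/andP[+ _] _ _]] := validI nN k.
by rewrite ler_pdivlMr ?mul1r // mulr_gt0 ?weight_gt0 ?dur_gt0.
Qed.

Lemma value_le n k : (n < N)%N ->
  value (it n) k <= theta S k * (weight (it n) k * (dur (it n) k)%:R).
Proof.
move=> nN; have [_ [/andP[_ +] _ _]] := validI nN k.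
by rewrite ler_pdivrMr // mulr_gt0 ?weight_gt0 ?dur_gt0.
Qed.

(** * Threshold functions *)

Lemma threshold0 k : phi k 0 = 0.
Proof. by rewrite /exp_threshold !mul0r expR0 subrr. Qed.

Lemma ler_threshold k : {homo phi k : u v / u <= v}.
Proof.
move=> u v uv; rewrite /exp_threshold lerB // ler_expR.
by rewrite !ler_wpM2r ?invr_ge0 ?(ltW (cap_gt0 k)) ?(ltW (rate_gt0 k)).
Qed.

Lemma threshold_ge0 k (u : R) : 0 <= u -> 0 <= phi k u.
Proof. by rewrite -{2}(threshold0 k); exact: ler_threshold. Qed.

(** The size bound keeps the increment of the exponent at most [ln 2], where [expR_sub1_le] makes
    the growth linear in [w]. *)
Lemma threshold_step k (u w : R) : 0 <= w <= eps S k ->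
  cap S k * phi k (u + w) <= cap S k * phi k u + 2 * g k * w * (phi k u + 1).
Proof.
move=> /andP[w0 we]; have C0 := cap_gt0 k; have g0 := rate_gt0 k.
rewrite /exp_threshold (mulrDl u) (mulrDl (u * _)) expRD.
set e := expR (u * _ / _); set y := w * _ / _.
have y0 : 0 <= y.
  by apply: divr_ge0; [apply: mulr_ge0; [|exact: ltW]|exact: ltW].
have y2 : y <= ln 2.
  rewrite /y ler_pdivrMr // -ler_pdivlMr // (le_trans we) //.
  by rewrite [ln 2 * _]mulrC.
have ey := expR_sub1_le y0 y2.
have e0 : 0 < e := expR_gt0 _.
have wE : g k * w = cap S k * y.
  by rewrite mulrC /y [RHS]mulrC divfK // gt_eqF.
have Ce : 0 < cap S k * e by rewrite mulr_gt0.
have := ler_wpM2l (ltW Ce) ey.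
rewrite -(mulrA 2 (g k)) wE; lra.
Qed.

(** * Utilizations along the run *)

Lemma OA_utilS n k t :
  z n.+1 k t = z n k t + weight (it n) k * (x n k)%:R * (t \in slots (it n) k)%:R.
Proof. by rewrite /=; case: ifP => _; rewrite ?mulr1 ?mulr0 ?addr0. Qed.

Lemma OA_utilE n k t :
  z n k t = \sum_(m < n) weight (it m) k * (x m k)%:R * (t \in slots (it m) k)%:R.
Proof.
elim: n => [|n IHn]; first by rewrite big_ord0.
by rewrite OA_utilS IHn big_ord_recr.
Qed.

Lemma OA_util_le m n k t : (m <= n <= N)%N -> z m k t <= z n k t.
Proof.
elim: n => [|n IHn]; first by rewrite leqn0 => /andP[/eqP->].
rewrite leq_eqVlt => /andP[/orP[/eqP->//|mn] nN].
apply: (@le_trans _ _ (z n k t)); first by rewrite IHn // -ltnS mn ltnW.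
by rewrite OA_utilS lerDl !mulr_ge0 ?ler0n // ltW // weight_gt0.
Qed.

Lemma OA_util_ge0 n k t : (n <= N)%N -> 0 <= z n k t.
Proof. by move=> nN; rewrite (@OA_util_le 0). Qed.

Lemma OA_util_out n k t : (n <= N)%N -> t \notin slotsT -> z n k t = 0.
Proof.
move=> nN tT; rewrite OA_utilE big1 // => -[m mn] _ /=.
have mN : (m < N)%N by rewrite (leq_trans mn).
by have /contraNF/(_ tT)-> := @slots_sub m k mN t; rewrite mulr0.
Qed.

(** * The admission rule *)

Lemma tie_argmax (a : item R K) h (A : {set 'I_K}) : A != finset.set0 ->
  tie h (OA_argmax a A) \in OA_argmax a A.
Proof.
move=> /set0Pn[j jA]; apply: validtie; apply/set0Pn.
case: (@arg_maxP _ _ _ j (mem A) (value a) jA) => i /= iA imax.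
by exists i; rewrite inE; apply/andP; split=> //; apply/forall_inP => l /imax.
Qed.

Lemma OA_alloc_candidate n k : x n k ->
  k \in OA_candidates S phi (z n) (it n).
Proof.
rewrite /OA_alloc /OA_decide => /andP[A0 /eqP->].
set A := OA_candidates _ _ _ _ in A0 *.
by have := tie_argmax (it n) (mkseq (items_of I) n.+1) A0; rewrite inE => /andP[].
Qed.

Lemma candidate_value_le n k : (n < N)%N ->
  k \in OA_candidates S phi (z n) (it n) ->
  value (it n) k <= \sum_(j < K) value (it n) j * (x n j)%:R.
Proof.
move=> nN kA; set A := OA_candidates _ _ _ _ in kA.
have A0 : A != finset.set0 by apply/set0Pn; exists k.
have := tie_argmax (it n) (mkseq (items_of I) n.+1) A0.
set j := tie _ _; rewrite inE => /andP[jA /forall_inP/(_ k kA) kj].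
rewrite (bigD1 j) //= /OA_alloc /OA_decide -/A A0 eqxx mulr1.
rewrite (le_trans kj) // lerDl sumr_ge0 // => i _.
by rewrite mulr_ge0 ?ler0n // ltW // value_gt0.
Qed.

(** * Growth of the potential *)

Lemma sum_slots n k (F : nat -> R) : (n < N)%N ->
  \sum_(t <- slots (it n) k) F t =
  \sum_(t <- slotsT) (t \in slots (it n) k)%:R * F t.
Proof.
by move=> nN; rewrite (sum_mem_uniq F (iota_uniq _ _) (iota_uniq _ _) (@slots_sub n k nN)).
Qed.

Lemma sum_slots_const n k (c : R) :
  \sum_(t <- slots (it n) k) c = (dur (it n) k)%:R * c.
Proof. by rewrite big_const_seq count_predT size_iota iter_addr_0 mulr_natl. Qed.

(* Admission means that the item pays its price, so the potential grows by at
   most 4 g_k times the value collected. *)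
Lemma potential_step n k : (n < N)%N ->
  \sum_(t <- slotsT) cap S k * phi k (z n.+1 k t) <=
  \sum_(t <- slotsT) cap S k * phi k (z n k t) +
  4 * g k * (value (it n) k * (x n k)%:R).
Proof.
move=> nN; case: (boolP (x n k)) => [xnk|xnk]; last first.
  rewrite mulr0 mulr0 addr0; apply: ler_sum => t _.
  by rewrite OA_utilS (negbTE xnk) mulr0 mul0r addr0.
set w := weight (it n) k.
apply: (@le_trans _ _ (\sum_(t <- slotsT) (cap S k * phi k (z n k t) +
    (t \in slots (it n) k)%:R * (2 * g k * (w * phi k (z n k t) + w))))).
  apply: ler_sum => t _; rewrite OA_utilS xnk mulr1.
  case: (t \in _); last by rewrite mulr0 mul0r !addr0.
  rewrite mulr1 mul1r (le_trans (threshold_step _ _)) //.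
    by rewrite ltW ?weight_gt0 // weight_le_eps.
  by rewrite -/w; lra.
rewrite big_split /= lerD2l -sum_slots // -mulr_sumr big_split /=.
rewrite sum_slots_const.
have := OA_alloc_candidate xnk; rewrite inE => /andP[+ _].
rewrite /OA_price -/w => pv.
have wv := value_ge k nN; have g0 := rate_gt0 k.
rewrite mulr1 -/w in wv *.
have -> : 4 * g k * value (it n) k = 2 * g k * (value (it n) k + value (it n) k) by ring.
apply: ler_wpM2l; first by apply: mulr_ge0 => //; exact: ltW.
by apply: lerD => //; rewrite mulrC.
Qed.

Lemma potential_le (G : R) n : (forall k, g k <= G) -> (n <= N)%N ->
  \sum_(k < K) \sum_(t <- slotsT) cap S k * phi k (z n k t) <=
  4 * G * \sum_(m < n) \sum_(k < K) value (it m) k * (x m k)%:R.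
Proof.
move=> gG; elim: n => [|n IHn] nN.
  rewrite big_ord0 mulr0 big1 // => k _; rewrite big1 // => t _.
  by rewrite /= threshold0 mulr0.
rewrite big_ord_recr /= mulrDr.
apply: (@le_trans _ _ (\sum_(k < K) (\sum_(t <- slotsT) cap S k * phi k (z n k t) +
  4 * G * (value (it n) k * (x n k)%:R)))); last first.
  by rewrite big_split /= -mulr_sumr lerD2r; exact: IHn (ltnW nN).
apply: ler_sum => k _; rewrite (le_trans (potential_step _ nN)) // lerD2l.
rewrite ler_wpM2r ?ler_wpM2l //.
by rewrite mulr_ge0 ?ler0n // ltW // value_gt0.
Qed.

(** * Rejection at a full slot *)

(* An interval of length at least L through tau, inside the positive slots,
   contains one of the two slots tau + j + 1 - L and tau + j + 1, which are at
   distance L. *)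
Lemma util_split n k (L j tau : nat) : (n <= N)%N ->
  (forall m, (m < N)%N -> (L <= dur (it m) k)%N) -> (j < L)%N ->
  z n k tau <= z n k (tau + j + 1 - L)%N + z n k (tau + j + 1)%N.
Proof.
move=> nN durL jL; rewrite !OA_utilE -big_split /=.
apply: ler_sum => -[m mn] _ /=.
have mN : (m < N)%N by rewrite (leq_trans mn).
rewrite -mulrDr ler_wpM2l ?mulr_ge0 ?ler0n ?(ltW (weight_gt0 k mN)) //.
rewrite -natrD ler_nat.
(* This covers truncation: if [tau + j + 1 <= L], an item through [tau] that starts at 1 or later
   ends at [L] or later, hence covers [tau + j + 1]. *)
have s0 : (0 < dur (it m) k)%N -> (0 < start (it m) k)%N.
  move=> d0; have := @slots_sub m k mN (start (it m) k).
  by rewrite !mem_iota; lia.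
have := durL m mN; rewrite !mem_iota; lia.
Qed.

(* The price of a rejection for lack of capacity: an item through a full slot
   tau may use only cheap slots, but averaging over a window of width 4 dur_hi
   lets each of its slots see the expensive ones around tau. *)
Definition full_price k : nat -> R :=
  smooth (Num.trunc (dur_hi S k)) (fun t => phi k (z N k t)).

Lemma full_price_ge0 k s : 0 <= full_price k s.
Proof. by apply: smooth_ge0 => t; rewrite threshold_ge0 // OA_util_ge0. Qed.

Lemma full_price_total k :
  \sum_(t <- slotsT) full_price k t <= 4 * \sum_(t <- slotsT) phi k (z N k t).
Proof.
apply: smooth_total => t; first by rewrite threshold_ge0 // OA_util_ge0.
by move=> tT; rewrite OA_util_out // threshold0.
Qed.

Lemma full_price_ge n k tau s : (n < N)%N ->
  tau \in slots (it n) k -> s \in slots (it n) k ->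
  cap S k < z n k tau + weight (it n) k -> theta S k <= full_price k s.
Proof.
move=> nN tauT sT full.
have [lo0 hilo] : 0 < dur_lo S k /\ dur_lo S k <= dur_hi S k.
  by case: validS => _ /(_ k)[].
have exL : exists d : nat, dur_lo S k <= d%:R.
  by exists (dur (it n) k); have /andP[] := dur_bounds k nN.
(* Durations are integers, so [dur_lo] may be rounded up, and likewise [dur_hi] down to [H]. *)
pose L := ex_minn exL.
have [loL minL] : dur_lo S k <= L%:R /\
    (forall d : nat, dur_lo S k <= d%:R -> (L <= d)%N).
  by rewrite /L; case: ex_minnP.
pose H := Num.trunc (dur_hi S k).
have hi0 : 0 <= dur_hi S k by rewrite (le_trans (ltW lo0)).
have durL m : (m < N)%N -> (L <= dur (it m) k)%N.
  by move=> /(dur_bounds k)/andP[+ _]; exact: minL.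
have durH : (dur (it n) k <= H)%N.
  by rewrite truncn_ge_nat //; have /andP[] := dur_bounds k nN.
have LH : (L <= H)%N := leq_trans (durL n nN) durH.
have L0 : (0 < L)%N by rewrite -(ltr0n R) (lt_le_trans lo0).
have C0 := cap_gt0 k; have g0 := rate_gt0 k.
pose b := phi k (z N k tau / 2).
have zN0 t : 0 <= z N k t by exact: OA_util_ge0.
have phi0 t : 0 <= phi k (z N k t) by exact: threshold_ge0.
have win : L%:R / H%:R * b <= full_price k s.
  apply: (smooth_window phi0 LH (tau := tau)).
  - by move: tauT sT; rewrite !mem_iota; lia.
  - by move: tauT sT; rewrite !mem_iota; lia.
  move=> j jL; have := @util_split N k L j tau (leqnn N) durL jL.
  set p := (_ - L)%N; set q := (tau + j + 1)%N => zpq.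
  (* One slot of the pair is at least half as full as [tau]. *)
  have [zp|zp] := leP (z N k tau / 2) (z N k p).
    by rewrite -[b]addr0 lerD // ler_threshold.
  by rewrite -[b]add0r lerD // ler_threshold //; lra.
apply: le_trans win.
have a1 := alpha_ge1 k; have th1 := theta_ge1 k.
(* The item did not fit and weighs at most [cap * ln 2 / g], so [tau] is filled to at least
   [cap * (1 - ln 2 / g)]. *)
have zlow : (g k - ln 2) / 2 <= z N k tau / 2 * g k / cap S k.
  have zz : z n k tau <= z N k tau by rewrite OA_util_le // (ltnW nN) leqnn.
  have we := le_trans (weight_le_eps k nN) (eps_small k).
  rewrite ler_pdivlMr //.
  have zC : cap S k - cap S k * ln 2 / g k <= z N k tau by lra.
  rewrite -(ler_pM2r g0) in zC.
  move: zC; rewrite mulrBl divfK ?gt_eqF //; lra.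
have bge : alpha S k * theta S k <= b.
  rewrite /b /exp_threshold lerBrDr.
  by rewrite (le_trans (expR_oa_rate a1 th1)) // ler_expR.
have H0 : 0 < H%:R :> R by rewrite ltr0n (leq_trans L0).
apply: (@le_trans _ _ (L%:R / H%:R * (alpha S k * theta S k))); last first.
  by rewrite ler_wpM2l // divr_ge0.
(* [L / H >= dur_lo / dur_hi], so the factor [alpha] in the bound on [b] makes up for [L / H]. *)
rewrite mulrA -[leLHS]mul1r ler_wpM2r ?(le_trans _ th1) //.
rewrite mulrAC ler_pdivlMr // mul1r /alpha.
have Hhi : H%:R <= dur_hi S k by rewrite truncn_le.
rewrite (le_trans Hhi) // mulrA ler_pdivlMr // mulrC.
by rewrite ler_wpM2r.
Qed.

(** * Weak duality *)

Definition dual_price k t : R := phi k (z N k t) + full_price k t.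

(** For a candidate [k] the first sum suffices. A price that was too high stays too high, since
    utilizations only grow. At a full slot, the value per unit of weight and slot is at most
    [theta], which [full_price] covers. *)
Lemma dual_feasible n k : (n < N)%N ->
  value (it n) k <= \sum_(j < K) value (it n) j * (x n j)%:R +
    \sum_(t <- slots (it n) k) weight (it n) k * dual_price k t.
Proof.
move=> nN; have w0 := weight_gt0 k nN.
have phi0 t : 0 <= phi k (z N k t) by rewrite threshold_ge0 ?OA_util_ge0.
have full0 := full_price_ge0 k.
have u0 : 0 <= \sum_(j < K) value (it n) j * (x n j)%:R.
  by apply: sumr_ge0 => j _; rewrite mulr_ge0 ?ler0n // ltW // value_gt0.
have d0 : 0 <= \sum_(t <- slots (it n) k) weight (it n) k * dual_price k t.
  apply: sumr_ge0 => t _; apply: mulr_ge0; first exact: ltW.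
  exact: addr_ge0.
case: (boolP (k \in OA_candidates S phi (z n) (it n))) => [kA|].
  by rewrite (le_trans (candidate_value_le nN kA)) // lerDl.
rewrite inE negb_and -ltNge => /orP[price|/allPn[tau tauT]]; last first.
  rewrite -ltNge => full; rewrite -[leLHS]add0r lerD //.
  rewrite (le_trans (value_le k nN)) //.
  rewrite [leLHS]mulrC -mulrA -sum_slots_const -mulr_sumr.
  rewrite (ler_wpM2l (ltW w0)) // big_seq [leRHS]big_seq; apply: ler_sum => s sT.
  rewrite -[leLHS]add0r lerD //; exact: full_price_ge full.
rewrite -[leLHS]add0r lerD // (le_trans (ltW price)) //.
apply: ler_sum => t _; rewrite (ler_wpM2l (ltW w0)) // -[leLHS]addr0 lerD //.
by rewrite ler_threshold // OA_util_le // (ltnW nN) leqnn.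
Qed.

Lemma ALG_ge0 : 0 <= ALG S phi tie I.
Proof.
apply: sumr_ge0 => -[m mN] _; apply: sumr_ge0 => k _ /=.
by rewrite mulr_ge0 ?ler0n // ltW // value_gt0.
Qed.

(** In [dual_feasible] summed over a feasible [y], the collected values give [ALG] once, and
    capacities turn the prices into at most [1 + 4] times the potential, itself at most [4 * G]
    times [ALG]. *)
Lemma OPT_le (G : R) : (forall k, g k <= G) ->
  OPT S I <= (1 + 20 * G) * ALG S phi tie I.
Proof.
move=> gG; have pot := potential_le gG (leqnn N).
have ALG0 := ALG_ge0.
have K0 : (0 < K)%N by case: validS.
have G0 : 0 <= G by apply: le_trans (gG (Ordinal K0)); rewrite ltW // rate_gt0.
apply: bigmax_le => [|y].
  by rewrite mulr_ge0 // addr_ge0 // mulr_ge0.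
move=> /andP[/forallP y1 /forallP ycap].
apply: (@le_trans _ _ (\sum_(n < N) \sum_(k < K)
   ((\sum_(j < K) value (it n) j * (x n j)%:R) * (y n k)%:R +
    \sum_(t <- slotsT) dual_price k t *
      ((t \in slots (it n) k)%:R * (weight (it n) k * (y n k)%:R))))).
  apply: ler_sum => n _; apply: ler_sum => k _.
  apply: le_trans (ler_wpM2r (ler0n _ _) (dual_feasible k (ltn_ord n))) _.
  rewrite mulrDl lerD2l sum_slots // mulr_suml; apply: ler_sum => t _.
  by rewrite le_eqVlt; apply/orP; left; apply/eqP; ring.
under eq_bigr do rewrite big_split /=.
rewrite big_split /= mulrDl mul1r lerD //.
  apply: ler_sum => n _; rewrite -mulr_sumr -natr_sum.
  rewrite -[leRHS]mulr1 ler_wpM2l ?lern1 ?y1 //.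
  by apply: sumr_ge0 => j _; rewrite mulr_ge0 ?ler0n // ltW // value_gt0.
rewrite exchange_big /=.
apply: (@le_trans _ _ (\sum_(k < K) \sum_(t <- slotsT) cap S k * dual_price k t)).
  apply: ler_sum => k _; rewrite exchange_big /= big_seq [leRHS]big_seq.
  apply: ler_sum => t tT; rewrite -mulr_sumr mulrC ler_wpM2r //.
    by rewrite addr_ge0 ?full_price_ge0 // threshold_ge0 // OA_util_ge0.
  have /allP/(_ t tT) := ycap k; apply: le_trans.
  rewrite [leRHS]big_mkcond /=; apply: ler_sum => n _.
  by case: ifP => _; rewrite ?mul1r ?mul0r.
apply: (@le_trans _ _ (5 * \sum_(k < K) \sum_(t <- slotsT) cap S k * phi k (z N k t))).
  rewrite mulr_sumr; apply: ler_sum => k _; rewrite -!mulr_sumr mulrCA.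
  rewrite ler_wpM2l ?(ltW (cap_gt0 k)) // big_split /=.
  by have := full_price_total k; lra.
apply: (@le_trans _ _ (5 * (4 * G * ALG S phi tie I))).
  by rewrite ler_wpM2l.
by rewrite le_eqVlt; apply/orP; left; apply/eqP; ring.
Qed.

End Competitiveness.

(* f = O(ln(alpha theta)) is read as: for every x0 > 1 there is a constant c,
   independent of all other data, with f <= c ln(alpha theta) whenever
   alpha theta >= x0; at alpha theta = 1 the right-hand side would be 0. *)
Theorem theorem1 (R : realType) :
  exists gamma : R -> R -> R,
    [/\ (forall a th : R, 1 <= a -> 1 <= th -> 0 < gamma a th),
        (forall x0 : R, 1 < x0 -> exists c : R,
           forall a th : R, 1 <= a -> 1 <= th -> x0 <= a * th ->
             gamma a th <= c * ln (a * th)) &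
        (forall x0 : R, 1 < x0 -> exists c : R,
           forall (K : nat) (S : setting R K) (tie : tie_rule R K),
             valid_setting S -> valid_tie_rule tie ->
             x0 <= alpha_max S * theta_max S ->
             (forall k : 'I_K,
                eps S k <= cap S k * ln 2 / gamma (alpha S k) (theta S k)) ->
             (competitive_ratio S (exp_threshold S gamma) tie
                <= (c * ln (alpha_max S * theta_max S))%:E)%E)].
Proof.
have ln4 : 0 <= ln (4 : R) by rewrite ln_ge0 // ler1n.
(* Absorbs an additive constant into a multiple of [ln X], with [X] bounded away from 1. *)
have scale (x0 X c : R) : 1 < x0 -> x0 <= X -> 0 <= c ->
    c <= c / ln x0 * ln X.
  move=> x01 x0X c0; have l0 := ln_gt0 x01.
  by rewrite mulrAC ler_pdivlMr // ler_wpM2l // ler_ln ?posrE; lra.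
exists oa_rate; split; first exact: oa_rate_gt0.
- move=> x0 x01; exists (2 * ln 4 / ln x0 + 2) => a th a1 th1 x0ath.
  by rewrite oa_rateE // (mulrDl (_ / _)) lerD2r scale // mulr_ge0.
(* The constant comes from [1 + 20 * (2 * ln 4 + 2 * ln X)]. *)
move=> x0 x01; exists ((1 + 40 * ln 4) / ln x0 + 40) => K S tie vS vtie.
set A := alpha_max S; set T := theta_max S => x0X small.
have l0 := ln_gt0 x01.
have K0 : (0 < K)%N by case: vS.
pose k1 := Ordinal K0.
have aA k : alpha S k <= A by exact: le_bigmax.
have tT k : theta S k <= T by exact: le_bigmax.
have A1 : 1 <= A := le_trans (alpha_ge1 vS k1) (aA k1).
have T1 : 1 <= T := le_trans (theta_ge1 vS k1) (tT k1).
have rate_le k : oa_rate (alpha S k) (theta S k) <= oa_rate A T.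
  have a1 := alpha_ge1 vS k; have t1 := theta_ge1 vS k.
  rewrite ler_wpM2l // ler_ln ?posrE ?ler_wpM2l ?ler_pM //; nra.
have bound : 1 + 20 * oa_rate A T <= ((1 + 40 * ln 4) / ln x0 + 40) * ln (A * T).
  rewrite oa_rateE // (mulrDl (_ / _)).
  by have := scale x0 (A * T) (1 + 40 * ln 4) x01 x0X ltac:(lra); lra.
apply: ge_ereal_sup => _ [I vI <-].
have opt := OPT_le vS vtie vI small rate_le.
set alg := ALG _ _ _ _ in opt *.
have alg0 : 0 <= alg := ALG_ge0 tie vI.
have rhs0 : 0 <= ((1 + 40 * ln 4) / ln x0 + 40) * ln (A * T).
  by rewrite (le_trans _ bound) // addr_ge0 // mulr_ge0 // ltW // oa_rate_gt0.
have opt0 : 0 <= OPT S I by exact: bigmax_ge_id.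
(* If [alg] is 0, so is [OPT], and the quotient is 0 by convention. *)
rewrite inver; case: eqP => [alg00|/eqP algN0].
  have -> : OPT S I = 0.
    by apply/eqP; rewrite eq_le opt0 andbT (le_trans opt) // alg00 mulr0.
  by rewrite mul0e lee_fin.
have algp : 0 < alg by rewrite lt_def algN0.
rewrite -EFinM lee_fin ler_pdivrMr // (le_trans opt) //.
by rewrite ler_wpM2r.
Qed.
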